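(* Let $\ell, n$ be positive integers with $\ell \leq n$. Let $H \leq S_n$ be a subgroup, and for each $\ell$-element subset $I$ of $[n]$ let $\rho_I := (h_I)^H$. Then $H$ is of the form $H = \operatorname{Comp}^{(n)} S$ for some subset $S \subseteq S_\ell$ if and only if both of the following hold: (a) $H = \operatorname{Aut} \{\rho_I \mid I \in \mathcal{P}_\ell(n)\}$; (b) for every $x \in [n]^n_{\neq}$ we have $$\bigl( \forall I \in \mathcal{P}_\ell(n) \; \exists J \in \mathcal{P}_\ell(n) \colon \operatorname{red}(x[I]) \in \operatorname{red}(\rho_J) \bigr) \implies \forall I \in \mathcal{P}_\ell(n) \colon x[I] \in \rho_I .$$
   Context: $[n] := \{1,\dots,n\}$; $\mathcal{P}_\ell(n)$ is the set of all $\ell$-element subsets of $[n]$; $A^m_{\neq}$ is the set of $m$-tuples over $A$ with pairwise distinct entries; $S_n$ is the symmetric group on $[n]$. Tuples $\mathbf{a} \in A^m$ are identified with maps $[m] \to A$, so permutations in $S_n$ are identified with elements of $[n]^n_{\neq}$. For $I \in \mathcal{P}_\ell(n)$, $h_I \colon [\ell] \to I$ is the unique order-isomorphism, also viewed as the $\ell$-tuple in $[n]^\ell_{\neq}$ listing the elements of $I$ in increasing order. For $x \in [n]^n$, $x[I] := x \circ h_I$ is the substring $(x_{i_1}, \dots, x_{i_\ell})$, where $I = \{i_1 < \dots < i_\ell\}$. For an $\ell$-tuple $\mathbf{u}$ of distinct integers, $\operatorname{red}(\mathbf{u}) \in S_\ell$ is the permutation obtained by replacing the $i$-th smallest entry of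 $\mathbf{u}$ by $i$ for each $i\in[\ell]$; for a set $\rho$ of such tuples, $\operatorname{red}(\rho) := \{\operatorname{red}(\mathbf{r}) \mid \mathbf{r} \in \rho\}$. For $\pi \in S_n$, let $\pi_I := h_{\pi(I)}^{-1} \circ \pi|_I \circ h_I \in S_\ell$ and $\operatorname{Pat}^{(\ell)} \pi := \{\pi_I \mid I \in \mathcal{P}_\ell(n)\}$. For $S \subseteq S_\ell$, $\operatorname{Comp}^{(n)} S := \{\tau \in S_n \mid \operatorname{Pat}^{(\ell)} \tau \subseteq S\}$. For $\mathbf{a} = (a_1,\dots,a_\ell) \in [n]^\ell_{\neq}$, $\mathbf{a}^H := \{(\sigma(a_1), \dots, \sigma(a_\ell)) \mid \sigma \in H\}$. A permutation $\pi \in S_n$ preserves a relation $\rho \subseteq [n]^k$ if $\pi(\mathbf{r}) = (\pi(r_1),\dots,\pi(r_k)) \in \rho$ for all $\mathbf{r} \in \rho$. For a set $R$ of relations on $[n]$, $\operatorname{Aut} R$ is the set of all $\pi \in S_n$ that preserve every $\rho \in R$. *)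

(* Defs.v *)
From HB Require Import structures.
From mathcomp Require Import all_boot all_order all_fingroup.

Set Implicit Arguments.
Unset Strict Implicit.
Unset Printing Implicit Defensive.

(* [n] is the type 'I_n = {0, ..., n-1}; the shift from {1, ..., n} preserves *)
(* the order, on which alone h_I and red depend.                             *)

Record subset_of_size (l n : nat) := SubsetOfSize {
  subset_val :> {set 'I_n};
  _ : #|subset_val| == l
}.

HB.instance Definition _ (l n : nat) := [isSub for @subset_val l n].
HB.instance Definition _ (l n : nat) := [Finite of subset_of_size l n by <:].

Record dtuple (m n : nat) := DTuple {
  dtuple_val :> {ffun 'I_m -> 'I_n};
  _ : injectiveb dtuple_val
}.

HB.instance Definition _ (m n : nat) := [isSub for @dtuple_val m n].
HB.instance Definition _ (m n : nat) := [Finite of dtuple m n by <:].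

Lemma dtuple_inj (m n : nat) (u : dtuple m n) : injective u.
Proof. exact/injectiveP/(valP u). Qed.

Lemma mk_dtuple_subproof (m n : nat) (f : 'I_m -> 'I_n) :
  injective f -> injectiveb (finfun f).
Proof. by move=> f_inj; apply/injectiveP => i j; rewrite !ffunE => /f_inj. Qed.

Definition mk_dtuple (m n : nat) (f : 'I_m -> 'I_n) (f_inj : injective f) :
    dtuple m n :=
  DTuple (mk_dtuple_subproof f_inj).

Section Enumeration.
Variables (l n : nat) (I : subset_of_size l n).

Lemma subset_card : #|I| = l.
Proof. exact/eqP/(valP I). Qed.

Definition h_fun (i : 'I_l) : 'I_n :=
  Order.enum_val (cast_ord (esym subset_card) i).

Lemma h_fun_inj : injective h_fun.
Proof. by move=> i j /Order.enum_val_inj/cast_ord_inj. Qed.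

Definition h : dtuple l n := mk_dtuple h_fun_inj.

Definition h_inv (x : 'I_n) (xI : x \in I) : 'I_l :=
  cast_ord subset_card (Order.enum_rank_in xI x).

Lemma h_mono (i j : 'I_l) : (h i <= h j) = (i <= j).
Proof.
rewrite [h i]ffunE [h j]ffunE.
have tot : total (<=%O : rel 'I_n) by exact: Order.le_total.
exact: (Order.le_enum_val tot (A := mem I)
  (cast_ord (esym subset_card) i) (cast_ord (esym subset_card) j)).
Qed.

Lemma h_mem (i : 'I_l) : h i \in I.
Proof. by rewrite [h i]ffunE; apply: Order.enum_valP. Qed.

Lemma h_invK (x : 'I_n) (xI : x \in I) : h (h_inv xI) = x.
Proof. by rewrite [LHS]ffunE /h_fun cast_ordK Order.enum_rankK_in. Qed.

Lemma hK (i : 'I_l) (hI : h i \in I) : h_inv hI = i.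
Proof. by apply: (@dtuple_inj _ _ h); rewrite h_invK. Qed.

End Enumeration.

Section Reduction.
Variables (l n : nat) (u : dtuple l n).

Lemma entries_card : #|[set u i | i : 'I_l]| == l.
Proof. by rewrite card_imset ?card_ord //; apply: dtuple_inj. Qed.

Definition entries : subset_of_size l n := SubsetOfSize entries_card.

Lemma entriesP (i : 'I_l) : u i \in entries.
Proof. exact: imset_f. Qed.

Definition red_fun (i : 'I_l) : 'I_l := h_inv (entriesP i).

Lemma red_fun_inj : injective red_fun.
Proof.
by move=> i j /(congr1 (h entries)); rewrite !h_invK => /dtuple_inj.
Qed.

(* The i-th smallest entry of u is h entries i, so replacing it by i amounts  *)
(* to composing u with the inverse of h entries.                              *)
Definition red : 'S_l := perm red_fun_inj.

End Reduction.

Definition red_set (l n : nat) (rho : {set {ffun 'I_l -> 'I_n}}) :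
    {set 'S_l} :=
  [set red r | r : dtuple l n & dtuple_val r \in rho].

Section Substring.
Variables (l n : nat) (x : dtuple n n) (I : subset_of_size l n).

Lemma substring_inj : injective (x \o h I).
Proof. exact: inj_comp (@dtuple_inj _ _ x) (@dtuple_inj _ _ (h I)). Qed.

Definition substring : dtuple l n := mk_dtuple substring_inj.

End Substring.

Section Pattern.
Variables (l n : nat) (pi : 'S_n) (I : subset_of_size l n).

Lemma perm_image_card : #|pi @: I| == l.
Proof. by rewrite card_imset ?subset_card //; apply: perm_inj. Qed.

Definition perm_image : subset_of_size l n := SubsetOfSize perm_image_card.

Lemma perm_imageP (i : 'I_l) : pi (h I i) \in perm_image.
Proof. by apply: imset_f; apply: h_mem. Qed.

Definition pattern_fun (i : 'I_l) : 'I_l := h_inv (perm_imageP i).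

Lemma pattern_fun_inj : injective pattern_fun.
Proof.
move=> i j /(congr1 (h perm_image)); rewrite !h_invK.
by move=> /perm_inj/dtuple_inj.
Qed.

Definition pattern : 'S_l := perm pattern_fun_inj.

End Pattern.

Definition Pat (l n : nat) (pi : 'S_n) : {set 'S_l} :=
  [set pattern pi I | I : subset_of_size l n].

Definition Comp (l n : nat) (S : {set 'S_l}) : {set 'S_n} :=
  [set tau : 'S_n | Pat l tau \subset S].

Definition perm_tuple (k n : nat) (pi : 'S_n) (r : {ffun 'I_k -> 'I_n}) :
    {ffun 'I_k -> 'I_n} :=
  [ffun i => pi (r i)].

Definition orbit_rel (k n : nat) (H : {set 'S_n}) (a : dtuple k n) :
    {set {ffun 'I_k -> 'I_n}} :=
  [set perm_tuple sigma a | sigma in H].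

Definition preserves (k n : nat) (pi : 'S_n)
    (rho : {set {ffun 'I_k -> 'I_n}}) : bool :=
  [forall r in rho, perm_tuple pi r \in rho].

Definition Aut_rel (k n : nat) (R : {set {set {ffun 'I_k -> 'I_n}}}) :
    {set 'S_n} :=
  [set pi : 'S_n | [forall rho in R, preserves pi rho]].

Definition rho (l n : nat) (H : {set 'S_n}) (I : subset_of_size l n) :
    {set {ffun 'I_l -> 'I_n}} :=
  orbit_rel H (h I).

(* Main.v *)
Require Import Defs.
From mathcomp Require Import all_boot all_order all_fingroup.

Set Implicit Arguments.
Unset Strict Implicit.
Unset Printing Implicit Defensive.

(** The union of the sets [red (rho_J)] is the union of [Pat sigma] over
    [sigma] in [H], because [pi_I = red (pi o h_I)].  If [H = Comp S], both a
    permutation preserving every [rho_I] and a tuple as in (b) have all their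
    patterns in [S], so they lie in [H].  Conversely, for [S] the union above,
    (b) makes any [tau] in [Comp S] agree on each [l]-subset with an element of
    [H]; using this on the subsets [sigma(I)] shows that [tau] preserves every
    [rho_I]. *)

Lemma perm_tupleE (k n : nat) (s : 'S_n) (r : {ffun 'I_k -> 'I_n}) i :
  perm_tuple s r i = s (r i).
Proof. exact: ffunE. Qed.

Lemma h_red (l n : nat) (u : dtuple l n) (i : 'I_l) :
  h (entries u) (red u i) = u i.
Proof. by rewrite permE h_invK. Qed.

Lemma h_pattern (l n : nat) (pi : 'S_n) (I : subset_of_size l n) (i : 'I_l) :
  h (perm_image pi I) (pattern pi I i) = pi (h I i).
Proof. by rewrite permE h_invK. Qed.

Lemma mem_h (l n : nat) (I : subset_of_size l n) (x : 'I_n) :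
  x \in I -> exists i, x = h I i.
Proof. by move=> xI; exists (h_inv xI); rewrite h_invK. Qed.

(** Both sides standardise the same tuple: the entries of [u] form exactly [pi(I)], so the two
    increasing enumerations coincide, and [h] is injective. *)
Lemma red_pattern (l n : nat) (pi : 'S_n) (I : subset_of_size l n)
    (u : dtuple l n) :
  dtuple_val u = perm_tuple pi (h I) -> red u = pattern pi I.
Proof.
move=> uE; have uiE i : u i = pi (h I i) by rewrite uE perm_tupleE.
have eqI : entries u = perm_image pi I.
  apply/val_inj/setP => y; apply/imsetP/imsetP => -[x xI ->].
    by exists (h I x); [apply: h_mem | apply: uiE].
  by have [i ->] := mem_h xI; exists i; rewrite ?uiE.
apply/permP => i; apply: (@dtuple_inj _ _ (h (entries u))).
by rewrite h_red eqI h_pattern.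
Qed.

Lemma dtuple_perm (n : nat) (x : dtuple n n) : exists tau : 'S_n, x =1 tau.
Proof. by exists (perm (@dtuple_inj _ _ x)) => i; rewrite permE. Qed.

Lemma perm_tuple_inj (k n : nat) (pi : 'S_n) (a : dtuple k n) :
  injective (fun i => pi (a i)).
Proof. by move=> i j /perm_inj/dtuple_inj. Qed.

Lemma substring_perm (l n : nat) (x : dtuple n n) (tau : 'S_n)
    (I : subset_of_size l n) :
  x =1 tau -> dtuple_val (substring x I) = perm_tuple tau (h I).
Proof. by move=> xE; apply/ffunP => i; rewrite !ffunE /= xE !ffunE. Qed.

(** Translates the hypothesis of (b) into a statement about patterns of elements of [H]. *)
Lemma red_set_rhoP (l n : nat) (H : {set 'S_n}) (J : subset_of_size l n)
    (p : 'S_l) :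
  reflect (exists2 sigma, sigma \in H & p = pattern sigma J)
          (p \in red_set (rho H J)).
Proof.
apply: (iffP imsetP) => [[r]|[sigma sH ->]].
  rewrite inE => /imsetP[sigma sH rE] ->.
  by exists sigma => //; apply: red_pattern.
have uE : dtuple_val (mk_dtuple (@perm_tuple_inj _ _ sigma (h J)))
    = perm_tuple sigma (h J) by [].
by exists (mk_dtuple (@perm_tuple_inj _ _ sigma (h J)));
  rewrite ?(red_pattern uE) // inE uE; apply: imset_f.
Qed.

(** In the product [s * t] the left factor acts first. *)
Lemma perm_tupleM (k n : nat) (s t : 'S_n) (r : {ffun 'I_k -> 'I_n}) :
  perm_tuple t (perm_tuple s r) = perm_tuple (s * t)%g r.
Proof. by apply/ffunP => i; rewrite !ffunE permM. Qed.

Lemma perm_tuple1 (k n : nat) (r : {ffun 'I_k -> 'I_n}) :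
  perm_tuple 1 r = r.
Proof. by apply/ffunP => i; rewrite ffunE perm1. Qed.

Lemma eq_perm_tuple_h (l n : nat) (s t : 'S_n) (I : subset_of_size l n) :
  perm_tuple s (h I) = perm_tuple t (h I) -> {in I, s =1 t}.
Proof.
by move=> /ffunP e x /mem_h[i ->]; have := e i; rewrite !perm_tupleE.
Qed.

Lemma subset_Aut_rho (l n : nat) (H : {group 'S_n}) :
  H \subset Aut_rel [set rho H I | I : subset_of_size l n].
Proof.
apply/subsetP => s sH; rewrite inE; apply/forall_inP => _ /imsetP[I _ ->].
apply/forall_inP => _ /imsetP[t tH ->]; rewrite perm_tupleM.
by apply: imset_f; apply: groupM.
Qed.

(** Since [H] contains the identity, [h I] itself belongs to [rho H I]. *)
Lemma Aut_rho_h (l n : nat) (H : {group 'S_n}) (pi : 'S_n)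
    (I : subset_of_size l n) :
  pi \in Aut_rel [set rho H J | J : subset_of_size l n] ->
  perm_tuple pi (h I) \in rho H I.
Proof.
rewrite inE => /forall_inP piR.
have /forall_inP : preserves pi (rho H I) by apply: piR; apply: imset_f.
by apply; apply/imsetP; exists 1%g; rewrite ?perm_tuple1.
Qed.

(** A member of [rho H I] is [s] applied to [h I] with [s] in [H], and its entries lie in [s(I)].
    There [tau] agrees with some [t] in [H], so [tau] sends this tuple to the image of [h I] under
    [s * t]. *)
Lemma Aut_rho_local (l n : nat) (H : {group 'S_n}) (tau : 'S_n) :
  (forall I : subset_of_size l n, perm_tuple tau (h I) \in rho H I) ->
  tau \in Aut_rel [set rho H I | I : subset_of_size l n].
Proof.
move=> tauH; rewrite inE; apply/forall_inP => _ /imsetP[I _ ->].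
apply/forall_inP => _ /imsetP[s sH ->].
have /imsetP[t tH /eq_perm_tuple_h tauE] := tauH (perm_image s I).
apply/imsetP; exists (s * t)%g; first exact: groupM.
by apply/ffunP => i; rewrite !perm_tupleE permM tauE ?perm_imageP.
Qed.

Theorem theorem4p2 (l n : nat) (l_gt0 : 0 < l) (n_gt0 : 0 < n) (le_ln : l <= n)
    (H : {group 'S_n}) :
  (exists S : {set 'S_l}, H = Comp n S :> {set 'S_n}) <->
  (H = Aut_rel [set rho H I | I : subset_of_size l n] :> {set 'S_n}) /\
  (forall x : dtuple n n,
     (forall I : subset_of_size l n, exists J : subset_of_size l n,
        red (substring x I) \in red_set (rho H J)) ->
     forall I : subset_of_size l n,
       dtuple_val (substring x I) \in rho H I).
Proof.
split=> [[S HS] | [HAut Hred]].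
  have pat_in s I : s \in H -> pattern s I \in S.
    rewrite HS inE => /subsetP; apply; exact: imset_f.
  have in_pat s : (forall I, pattern s I \in S) -> s \in H.
    by move=> sS; rewrite HS inE; apply/subsetP => _ /imsetP[I _ ->].
  split=> [|x xred I].
    apply/eqP; rewrite eqEsubset subset_Aut_rho; apply/subsetP => s sAut.
    apply: in_pat => I; have /imsetP[t tH e] := Aut_rho_h I sAut.
    (* The tuple [u] arises from [h I] by [s] and also by [t], so [s] and [t] have the same pattern
       at [I]. *)
    pose u := mk_dtuple (@perm_tuple_inj _ _ s (h I)).
    have uE : dtuple_val u = perm_tuple s (h I) by [].
    by rewrite -(red_pattern uE) (red_pattern (etrans uE e)) pat_in.
  have [tau xE] := dtuple_perm x.
  (* It suffices that [tau] itself lies in [H], which is checked on the patterns at all subsets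
     [J]. *)
  rewrite (substring_perm I xE); apply: imset_f; apply: in_pat => J.
  have [K /red_set_rhoP[s sH]] := xred J.
  by rewrite (red_pattern (substring_perm J xE)) => ->; apply: pat_in.
exists (\bigcup_(s in H) Pat l s); apply/setP => tau; apply/idP/idP => [tauH|].
  by rewrite inE; apply: (bigcup_sup tau).
(* By (a), local agreement with [H] on each [l]-subset is enough; this is the conclusion of (b) for
   [tau] read as a tuple. *)
rewrite inE => /subsetP tauS; rewrite HAut; apply: Aut_rho_local.
pose x := mk_dtuple (@perm_inj _ tau).
have xE : x =1 tau by move=> i; rewrite ffunE.
move=> I; rewrite -(substring_perm I xE); apply: Hred => {}I.
have /tauS/bigcupP[s sH /imsetP[J _ e]] : pattern tau I \in Pat l tau.
  exact: imset_f.
exists J; apply/red_set_rhoP; exists s => //.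
by rewrite (red_pattern (substring_perm I xE)).
Qed.
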